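(* Let $\mathfrak m_0=\{[0,0],[0,1],[0,1],[1,1],[1,2]\}$. Then $\mathfrak m_0$ is neither of Speh type nor distinguished. Nevertheless, every standard order of $\mathfrak m_0$ whose sequence of endpoints is non-increasing admits a relevant decomposition. In particular, the canonical order of $\mathfrak m_0$ introduced by Mitra, Offen and Sayag (a particular standard order with non-increasing endpoints) admits a non-trivial relevant decomposition. There are exactly three standard orders of $\mathfrak m_0$ that admit no relevant decomposition, two of which have non-increasing beginnings.
   Context: A segment is a set $[a,b]=\{a,a+1,\ldots,b\}$ of consecutive integers, $a\le b$; write $\mathbf b([a,b])=a$ (beginning), $\mathbf e([a,b])=b$ (endpoint), and $\mathrm{Sgm}$ for the set of segments. Put $\nu[a,b]=[a+1,b+1]$. A multisegment is a finitely supported function $\mathfrak m:\mathrm{Sgm}\to\mathbb Z_{\ge0}$ (a finite multiset of segments); sums are pointwise; $(\nu\mathfrak m)(\Delta)=\mathfrak m(\nu^{-1}\Delta)$. An order of $\mathfrak m$ is a listing (sequence of segments) $(\Delta_1,\ldots,\Delta_k)$ in which each segment $\Delta$ occurs exactly $\mathfrak m(\Delta)$ times; orders are counted as sequences of segments, so equal segments are not distinguished. Write $[a,b]\prec[a',b']$ if $a<a'$, $b<b'$ and $b\ge a'-1$. An order is standard if $\Delta_i\not\prec\Delta_j$ whenever $i<j$. The canonical order of Mitra, Offen and Sayag is a specific standard order, attached by these authors to each multisegment in their work on hypotheses about distinguished multisegments, whose sequence of endpoints is non-increasing; it is thus one of the standard orders with non-increasing endpoints to which the claim refers. A decomposition of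 a segment $\Delta$ is a tuple of segments $(\Delta_1,\ldots,\Delta_r)$, $r\ge1$, with $\mathbf e(\Delta_1)=\mathbf e(\Delta)$, $\mathbf b(\Delta_r)=\mathbf b(\Delta)$ and $\mathbf e(\Delta_{i+1})=\mathbf b(\Delta_i)-1$ for $1\le i\le r-1$. A decomposition of an order $(\Delta_1,\ldots,\Delta_k)$ is a choice of a decomposition $(\Delta_{i,1},\ldots,\Delta_{i,k_i})$ of each $\Delta_i$; it is trivial if all $k_i=1$. Its index set is $I=\{(i,j):1\le i\le k,\ 1\le j\le k_i\}$, ordered lexicographically ($\prec_{\mathrm{lex}}$), and $(i,j)\ll(i',j')$ means $i<i'$. The decomposition is relevant to the order if there is an involution $\tau:I\to I$ with: (R1) $\tau(i,j+1)\ll\tau(i,j)$ for all $1\le i\le k$, $1\le j\le k_i-1$; (R2) $\tau(\imath)\ne\imath$ for all $\imath\in I$; (R3) $\Delta_\imath=\nu\Delta_{\tau(\imath)}$ whenever $\imath\prec_{\mathrm{lex}}\tau(\imath)$. An order admits a relevant decomposition if some decomposition of it is relevant to it. $\mathfrak m$ is distinguished if every standard order of $\mathfrak m$ admits a relevant decomposition. $\mathfrak m$ is of Speh type if $\mathfrak m=\mathfrak n+\nu\mathfrak n$ for some multisegment $\mathfrak n$. *)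

(* Defs.v *)
From HB Require Import structures.
From mathcomp Require Import all_boot all_order all_algebra.
From mathcomp Require Import finmap multiset.

Set Implicit Arguments.
Unset Strict Implicit.
Unset Printing Implicit Defensive.

Import Order.TTheory GRing.Theory Num.Theory.

Local Open Scope fset_scope.
Local Open Scope mset_scope.
Local Open Scope ring_scope.

(* The segment {a, a+1, .., b} is encoded by the pair (a, b) with a <= b. *)
Record sgm := Sgm { sgm_ends : int * int; _ : sgm_ends.1 <= sgm_ends.2 }.

HB.instance Definition _ := [isSub for sgm_ends].
HB.instance Definition _ := [Choice of sgm by <:].

Definition mk_sgm (a b : int) (le_ab : a <= b) : sgm :=
  @Sgm (a, b) le_ab.

Definition bgn (D : sgm) : int := (sgm_ends D).1.
Definition edn (D : sgm) : int := (sgm_ends D).2.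

Lemma sgm_le (D : sgm) : bgn D <= edn D.
Proof. exact: valP D. Qed.

Lemma shift_subproof (c : int) (D : sgm) : bgn D + c <= edn D + c.
Proof. by rewrite lerD2r sgm_le. Qed.

Definition shift (c : int) (D : sgm) : sgm := mk_sgm (shift_subproof c D).

Definition nu : sgm -> sgm := shift 1.
Definition nu_inv : sgm -> sgm := shift (-1).

Lemma nuK : cancel nu nu_inv.
Proof. by case=> [[a b] le_ab]; apply: val_inj; rewrite /= !addrK. Qed.

Lemma nu_invK : cancel nu_inv nu.
Proof. by case=> [[a b] le_ab]; apply: val_inj; rewrite /= !subrK. Qed.

Definition nu_mset (m : {mset sgm}) : {mset sgm} :=
  [fsfun D in [fset nu D' | D' in finsupp m] => m (nu_inv D)].

Lemma nu_msetE (m : {mset sgm}) (D : sgm) : nu_mset m D = m (nu_inv D).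
Proof.
rewrite /nu_mset fsfunE; case: ifPn => // notin.
apply/esym/fsfun_dflt; apply: contra notin => D_in.
by apply/imfsetP; exists (nu_inv D); rewrite //= nu_invK.
Qed.

Definition speh_type (m : {mset sgm}) : Prop :=
  exists n : {mset sgm}, m = n `+` nu_mset n.

Definition prec (D D' : sgm) : bool :=
  [&& bgn D < bgn D', edn D < edn D' & bgn D' - 1 <= edn D].

Definition is_order (m : {mset sgm}) (o : seq sgm) : Prop :=
  forall D : sgm, count_mem D o = m D.

Definition standard (o : seq sgm) : bool :=
  pairwise (fun D D' => ~~ prec D D') o.

Definition standard_order (m : {mset sgm}) (o : seq sgm) : Prop :=
  is_order m o /\ standard o.

Definition nonincr_edn (o : seq sgm) : bool := sorted >=%R (map edn o).
Definition nonincr_bgn (o : seq sgm) : bool := sorted >=%R (map bgn o).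

(* The pieces are listed from the endpoint down to the beginning. *)
Definition sgm_decomposition (D : sgm) (s : seq sgm) : bool :=
  if s is D1 :: s' then
    [&& edn D1 == edn D, bgn (last D1 s') == bgn D
      & path (fun A B => edn B == bgn A - 1) D1 s']
  else false.

Definition decomposition (o : seq sgm) (d : seq (seq sgm)) : bool :=
  all2 sgm_decomposition o d.

Definition trivial_decomposition (d : seq (seq sgm)) : bool :=
  all (fun s => size s == 1%N) d.

(* Index pairs (i, j) are numbered from 0. *)
Definition index_set (d : seq (seq sgm)) : pred (nat * nat) :=
  [pred p | (p.1 < size d)%N && (p.2 < size (nth [::] d p.1))%N].

(* Only evaluated on index_set d, where the default value is irrelevant. *)
Definition piece (d : seq (seq sgm)) (p : nat * nat) : sgm :=
  nth (mk_sgm (lexx 0)) (nth [::] d p.1) p.2.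

Definition lex_lt (p q : nat * nat) : bool :=
  ((p : (nat *l nat)%type) < (q : (nat *l nat)%type))%O.

Definition row_lt (p q : nat * nat) : bool := (p.1 < q.1)%N.

(* tau is an involution of index_set d; its values elsewhere are
   unconstrained. *)
Definition relevant (d : seq (seq sgm)) : Prop :=
  exists tau : nat * nat -> nat * nat,
    [/\ {in index_set d, forall p, tau p \in index_set d},
        {in index_set d, cancel tau tau},
        forall i j : nat, (i, j.+1) \in index_set d ->
          row_lt (tau (i, j.+1)) (tau (i, j)),
        {in index_set d, forall p, tau p != p}
      & {in index_set d, forall p, lex_lt p (tau p) ->
          piece d p = nu (piece d (tau p))}].

Definition relevant_decomposition (o : seq sgm) (d : seq (seq sgm)) : Prop :=
  decomposition o d /\ relevant d.

Definition admits_relevant (o : seq sgm) : Prop :=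
  exists d, relevant_decomposition o d.

Definition admits_nontrivial_relevant (o : seq sgm) : Prop :=
  exists d, relevant_decomposition o d /\ ~~ trivial_decomposition d.

Definition distinguished (m : {mset sgm}) : Prop :=
  forall o, standard_order m o -> admits_relevant o.

(* The canonical order of Mitra, Offen and Sayag is one such rule.  Statements
   about it are made for all rules with these properties. *)
Definition canonical_order_rule (can : {mset sgm} -> seq sgm) : Prop :=
  forall m, standard_order m (can m) /\ nonincr_edn (can m).

Lemma canonical_order_rule_ex : exists can, canonical_order_rule can.
Proof.
pose r : rel sgm := fun D D' => edn D' <= edn D.
have r_tr : transitive r by move=> y x z xy yz; apply: le_trans yz xy.
have r_tot : total r by move=> x y; apply: le_total.
exists (fun m => sort r (enum_mset m)) => m.
have srt : sorted r (sort r (enum_mset m)) by apply: sort_sorted.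
split; last by rewrite /nonincr_edn sorted_map.
split; first by move=> D; rewrite (permP (permEl (perm_sort _ _))) count_mem_mset.
rewrite /standard; move: srt; rewrite (sorted_pairwise r_tr).
apply: sub_pairwise => D D' le_e; rewrite /prec; apply/negP=> /and3P[_ lt_e _].
by move: (lt_le_trans lt_e le_e); rewrite ltxx.
Qed.

Notation "[sgm a ; b ]" := (@mk_sgm a%Z b%Z isT)
  (at level 0, a at level 99, b at level 99, format "[sgm  a ;  b ]").

Definition m0 : {mset sgm} :=
  [mset [sgm 0; 0]; [sgm 0; 1]; [sgm 0; 1]; [sgm 1; 1]; [sgm 1; 2]].

(* Main.v *)
Require Import Defs.
From HB Require Import structures.
From mathcomp Require Import all_boot all_order all_algebra.
From mathcomp Require Import finmap multiset.
From mathcomp Require Import zify.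

Set Implicit Arguments.
Unset Strict Implicit.
Unset Printing Implicit Defensive.

Local Open Scope mset_scope.

(** The multisegment m0 = {[0,0], [0,1], [0,1], [1,1], [1,2]} has only nine
standard orders, and each has only eight decompositions, so everything but the
Speh part is a finite question. It is settled by deciding relevance:
decompositions of an order are enumerated ([mem_decs]), the involutions that
make a decomposition relevant are enumerated as graphs built one index at a
time ([mem_graphs], [relevantP]), and the nine orders are then computed with.

What the computation finds can be seen by hand. Matched pieces are of the form
nu D, D with nu D coming first. So a piece [0,1] is matched with an earlier
[1,2], a piece {0} with an earlier {1}, a piece {2} with a later {1}, and a
piece {1} with an earlier {2} or a later {0}. Moreover, if a segment is split in
two, its second piece is matched into a strictly earlier row than its first
piece; in particular the two are not matched with each other. Hence either [1,2]
is kept whole and matched with one of the two [0,1], the other being split, or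
all segments with two points are split. In particular a relevant decomposition
is never trivial.

The orders that fail are

  (11)(12)(00)(01)(01),   (12)(11)(00)(01)(01),   (12)(01)(11)(00)(01),

and each of them ends with [0,1].
- If [1,2] is whole, the split [0,1] is not the last segment, since its piece
  {1} needs a {0} in a later row. Hence it is the first [0,1]. In the first two
  orders no piece {0} comes in a later row. In the third, its {1} takes [0,0],
  and its {0} is left with [1,1], which comes too late.
- If everything is split, the {1} of the last segment takes the only {2}, and
  the {0} of the last segment must be matched with a {1} before [1,2]. There is
  none in the last two orders; in the first one it is [1,1], and then the {1} of
  the first [0,1] has neither a {2} nor a later {0} left.

The standard orders with non-increasing endpoints are

  (12)(11)(01)(01)(00),   (12)(01)(11)(01)(00),   (12)(01)(01)(11)(00).

In the first two, match [1,2] with the first [0,1], split the second [0,1], and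
match its {1} with [0,0] and its {0} with [1,1]. In the third, split everything,
match the {2} with [1,1], and match the {1} of each split segment with the {0}
of the next segment that contains 0.

Finally m0 = n + nu n would force n to contain [0,1] twice, because [-1,0] is
not in m0, and then m0 would contain [1,2] twice. *)

(** * Functions with prescribed values, as lists of pairs *)

Section ConstrainedGraphs.
Variables (T U : eqType) (cand : T -> seq U) (c : rel (T * U)).

(** The functions on the list [ps] that map each point into its candidate list
and whose graph is pairwise [c]-related; a partial graph that violates [c] is
dropped at once, which keeps the enumeration small. *)
Fixpoint graphs (ps : seq T) : seq (seq (T * U)) :=
  if ps is p :: ps' then
    flatten [seq [seq (p, q) :: g | q <- cand p & all (c (p, q)) g]
            | g <- graphs ps']
  else [:: [::]].

Lemma mem_graphs ps g :
  (g \in graphs ps) =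
  [&& unzip1 g == ps, all (fun x => x.2 \in cand x.1) g & pairwise c g].
Proof.
elim: ps g => [|p ps IH] [|[p' q] g] //=.
  by apply/negbTE/negP=> /flatten_mapP[g _ /mapP[]].
apply/flatten_mapP/and3P => [[g' g'in /mapP[q']]|].
  rewrite mem_filter => /andP[allc q'in] [-> -> ->].
  move: g'in; rewrite IH => /and3P[/eqP<- -> ->].
  by rewrite q'in allc.
case=> /eqP[-> gps] /andP[qin gin] /andP[qg gg].
exists g; first by rewrite IH gps eqxx gin.
by apply/mapP; exists q; rewrite // mem_filter qg.
Qed.

End ConstrainedGraphs.

(** * Deciding relevance *)

Definition indices (d : seq (seq sgm)) : seq (nat * nat) :=
  [seq (i, j) | i <- iota 0 (size d), j <- iota 0 (size (nth [::] d i))].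

Lemma mem_indices d : indices d =i index_set d.
Proof.
move=> [i j]; rewrite [RHS]inE /=.
apply/allpairsPdep/andP => [[i' [j' []]]|[lti ltj]].
  by rewrite !mem_iota /= => lti ltj [-> ->].
by exists i, j; rewrite !mem_iota.
Qed.

(** The values of the involution at [p] that its shift condition allows. The shift
condition at its partner is imposed as well, so that wrong values are rejected
as soon as one of the two indices is treated. *)
Definition partners (d : seq (seq sgm)) (p : nat * nat) : seq (nat * nat) :=
  [seq q <- indices d |
    [&& q != p, lex_lt p q ==> (piece d p == nu (piece d q))
      & lex_lt q p ==> (piece d q == nu (piece d p))]].

(** The row condition on consecutive pieces of a segment, read on two points [x]
and [y] of the graph of an involution. *)
Definition descending (x y : (nat * nat) * (nat * nat)) : bool :=
  (y.1 == (x.1.1, x.1.2.+1)) ==> row_lt y.2 x.2.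

(** Being an involution and satisfying the row condition concern pairs of points
of the graph. Both are symmetrized here, so that checking them for each unordered
pair is enough. *)
Definition compatible (x y : (nat * nat) * (nat * nat)) : bool :=
  [&& (x.2 == y.1) == (y.2 == x.1), descending x y & descending y x].

Lemma compatible_refl : reflexive compatible.
Proof.
move=> [[i j] q]; rewrite /compatible /descending /= eqxx /= xpair_eqE.
by rewrite (ltn_eqF (ltnSn j)) andbF.
Qed.

Lemma compatible_sym : symmetric compatible.
Proof. by move=> x y; rewrite /compatible eq_sym [X in _ && X]andbC. Qed.

Definition matchings (d : seq (seq sgm)) :
    seq (seq ((nat * nat) * (nat * nat))) :=
  graphs (partners d) compatible (indices d).

(** Relevance asks for a function whose graph is in [matchings d]: on the index
set the values are constrained by [partners] and the pairs of values by
[compatible], and outside of it they are arbitrary. *)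
Lemma relevantP d : reflect (relevant d) (matchings d != [::]).
Proof.
apply: (iffP idP) => [|[tau [tauI tauK tau_row tau_neq tau_nu]]].
  case E: (matchings d) => [//|g gs] _.
  have: g \in matchings d by rewrite E mem_head.
  rewrite mem_graphs => /and3P[/eqP g1 /allP gpart].
  rewrite (pairwise_all2rel compatible_refl compatible_sym) => /allrelP gcomp.
  pose tau p := nth p (unzip2 g) (index p (unzip1 g)).
  have tau_in p : p \in index_set d -> (p, tau p) \in g.
    rewrite -mem_indices -g1 /tau => pin.
    have lt_g : index p (unzip1 g) < size g by rewrite -(size_map fst) index_mem.
    rewrite -[in X in (X, _)](nth_index p pin) -nth_zip ?size_map //.
    by rewrite zip_unzip mem_nth.
  have tauP p : p \in index_set d -> tau p \in partners d p.
    by move/tau_in/gpart.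
  have tauI p : p \in index_set d -> tau p \in index_set d.
    by move/tauP; rewrite mem_filter mem_indices => /andP[].
  have tauC p q : p \in index_set d -> q \in index_set d ->
      compatible (p, tau p) (q, tau q).
    by move=> /tau_in pin /tau_in qin; apply: gcomp.
  exists tau; split=> //.
  - move=> p pI; have /and3P[/=] := tauC _ _ pI (tauI _ pI).
    by rewrite eqxx => /eqP/esym/eqP.
  - move=> i j ijI.
    have ijI' : (i, j) \in index_set d.
      by move: ijI; rewrite !inE /= => /andP[->] /ltnW.
    by have /and3P[_] := tauC _ _ ijI' ijI; rewrite /descending /= eqxx.
  - by move=> p /tauP; rewrite mem_filter => /andP[/and3P[]].
  - move=> p /tauP; rewrite mem_filter => /andP[/and3P[_ /implyP H _] _].
    by move=> /H/eqP.
suff: [seq (p, tau p) | p <- indices d] \in matchings d.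
  by case: (matchings d).
rewrite mem_graphs (pairwise_all2rel compatible_refl compatible_sym).
rewrite /unzip1 -map_comp map_id eqxx /=.
apply/andP; split.
  apply/allP=> _ /mapP[p pin ->] /=; rewrite mem_indices in pin.
  rewrite mem_filter mem_indices tauI // tau_neq //= andbT.
  apply/andP; split; apply/implyP=> lt_p; apply/eqP; first exact: tau_nu.
  by rewrite -[in RHS](tauK p) //; apply: tau_nu; rewrite ?tauI ?tauK.
have desc p q : q \in index_set d -> descending (p, tau p) (q, tau q).
  move=> qI; apply/implyP=> /= /eqP qE; rewrite qE in qI *.
  by rewrite [X in row_lt _ (tau X)]surjective_pairing; apply: tau_row.
apply/allrelP=> _ _ /mapP[p pI ->] /mapP[q qI ->].
rewrite !mem_indices in pI qI; rewrite /compatible !desc //= andbT.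
by apply/eqP; apply/eqP/eqP => <-; rewrite tauK.
Qed.

(** * Enumerating decompositions and standard orders *)

Section Decompositions.
Import Order.TTheory GRing.Theory Num.Theory.
Local Open Scope ring_scope.

Lemma sgmP (D D' : sgm) : bgn D = bgn D' -> edn D = edn D' -> D = D'.
Proof.
case: D D' => [[a b] ab] [[a' b'] ab'] /= ea eb; apply: val_inj => /=.
by move: ea eb; rewrite /bgn /edn /= => -> ->.
Qed.

Lemma bgn_mk (a b : int) (ab : a <= b) : bgn (mk_sgm ab) = a.
Proof. by []. Qed.

Lemma edn_mk (a b : int) (ab : a <= b) : edn (mk_sgm ab) = b.
Proof. by []. Qed.

Lemma grow_subproof (D : sgm) : bgn D <= edn D + 1.
Proof. by have := sgm_le D; lia. Qed.

Definition grow (D : sgm) : sgm := mk_sgm (grow_subproof D).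

Definition point (a : int) : sgm := mk_sgm (lexx a).

Definition grow_head (s : seq sgm) : seq sgm :=
  if s is D :: s' then grow D :: s' else [::].

(** In a decomposition of [a, a + n + 1] the largest point either forms a piece
of its own or extends the first piece of a decomposition of [a, a + n]. *)
Fixpoint decs_from (a : int) (n : nat) : seq (seq sgm) :=
  if n is n'.+1 then
    [seq point (a + n%:Z) :: s | s <- decs_from a n'] ++
    [seq grow_head s | s <- decs_from a n']
  else [:: [:: point a]].

(** This excludes several pieces in a decomposition of a single point. *)
Lemma bgn_last_lt D D' s :
  path (fun A B => edn B == bgn A - 1) D (D' :: s) ->
  bgn (last D (D' :: s)) < bgn D.
Proof.
elim: s D D' => [|D2 s IH] D D' /= /andP[/eqP eD].
  by have := sgm_le D'; lia.
by move/IH => /=; have := sgm_le D'; lia.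
Qed.

Lemma mem_decs_from n (D : sgm) s : edn D = bgn D + n%:Z ->
  (s \in decs_from (bgn D) n) = sgm_decomposition D s.
Proof.
elim: n D s => [|n IH] D s eD.
  rewrite /= inE; apply/eqP/idP => [->|] /=.
    by rewrite edn_mk bgn_mk eD addr0 !eqxx.
  case: s => [//|D1 [|D2 s]] /= /and3P[/eqP e1 /eqP b1].
    by move=> _; congr [:: _]; apply: sgmP; rewrite ?bgn_mk ?edn_mk; lia.
  by move/bgn_last_lt => /=; have := sgm_le D1; lia.
have le_D' : bgn D <= edn D - 1 by lia.
have [D' bD' eDD'] : exists2 D', bgn D' = bgn D & edn D' = edn D - 1.
  by exists (mk_sgm le_D').
have eD' : edn D' = bgn D' + n%:Z by lia.
rewrite [decs_from _ _]/= mem_cat -bD'.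
apply/orP/idP => [[]/mapP[]|].
- move=> [|D1 t]; rewrite IH // => /and3P[/eqP e1 b1 p1] -> //=.
  rewrite edn_mk bgn_mk -bD' b1 p1 andbT /=.
  by apply/andP; split; apply/eqP; rewrite ?e1; lia.
- move=> [|D1 t]; rewrite IH // => /and3P[/eqP e1 b1 p1] -> //=.
  rewrite edn_mk e1 eDD' subrK eqxx -bD' -(eqP b1) /=.
  by apply/andP; split; case: (t) p1.
case: s => [//|D1 s] /= /and3P[/eqP e1 /eqP b1 p1].
(* Whether the first piece is the single point [edn D] tells which of the two
   constructors of [decs_from] was used. *)
have [bD1|lt_D1] := eqVneq (bgn D1) (edn D1).
  left; apply/mapP; exists s; last first.
    by congr (_ :: _); apply: sgmP; rewrite ?bgn_mk ?edn_mk; lia.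
  case: s b1 p1 => [|D2 s] /= b1; first by lia.
  rewrite IH // => /andP[/eqP e2 p2] /=; rewrite p2 b1 bD' eqxx /=.
  by rewrite andbT; apply/eqP; lia.
have le_D1' : bgn D1 <= edn D1 - 1 by have := sgm_le D1; move/eqP: lt_D1; lia.
right; apply/mapP; exists (mk_sgm le_D1' :: s); last first.
  by congr (_ :: _); apply: sgmP; rewrite ?bgn_mk ?edn_mk ?subrK.
rewrite IH //= edn_mk bD' -b1; apply/and3P; split; first by apply/eqP; lia.
  by case: (s).
by case: (s) p1.
Qed.

Definition sgm_decs (D : sgm) : seq (seq sgm) :=
  decs_from (bgn D) `|edn D - bgn D|%N.

Lemma mem_sgm_decs D s : (s \in sgm_decs D) = sgm_decomposition D s.
Proof. by apply: mem_decs_from; have := sgm_le D; lia. Qed.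

Fixpoint decs (o : seq sgm) : seq (seq (seq sgm)) :=
  if o is D :: o' then [seq s :: d | s <- sgm_decs D, d <- decs o']
  else [:: [::]].

Lemma mem_decs o d : (d \in decs o) = decomposition o d.
Proof.
elim: o d => [|D o IH] [|s d] //=.
  by apply/negbTE/negP => /allpairsP[[? ?] []].
apply/allpairsP/andP => [[[s' d'] /= [s'D d'o [-> ->]]]|[sD d_o]].
  by rewrite -mem_sgm_decs s'D -IH.
by exists (s, d); rewrite /= mem_sgm_decs IH.
Qed.

End Decompositions.

Definition relevant_decs (o : seq sgm) : seq (seq (seq sgm)) :=
  [seq d <- decs o | matchings d != [::]].

Lemma mem_relevant_decs o d :
  reflect (relevant_decomposition o d) (d \in relevant_decs o).
Proof.
rewrite mem_filter mem_decs andbC.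
by apply: (iffP andP) => -[od /relevantP].
Qed.

Lemma admits_relevantP o :
  reflect (admits_relevant o) (relevant_decs o != [::]).
Proof.
apply: (iffP idP) => [|[d /mem_relevant_decs]]; last by case: relevant_decs.
case E: relevant_decs => [//|d ds] _.
by exists d; apply/mem_relevant_decs; rewrite E mem_head.
Qed.

Definition standard_orders (s : seq sgm) : seq (seq sgm) :=
  [seq o <- permutations s | standard o].

Lemma mem_standard_orders (s o : seq sgm) :
  reflect (standard_order (seq_mset s) o) (o \in standard_orders s).
Proof.
rewrite mem_filter mem_permutations; apply: (iffP andP) => -[].
  by move=> std /permP os; split=> // D; rewrite mset_seqE os.
move=> os std; split=> //; apply/allP=> D _ /=.
by rewrite os mset_seqE.
Qed.

(** * The multisegment m0 *)

Definition m0_segments : seq sgm :=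
  [:: [sgm 0; 0]; [sgm 0; 1]; [sgm 0; 1]; [sgm 1; 1]; [sgm 1; 2]].

Lemma m0_seq_mset : m0 = seq_mset m0_segments.
Proof.
apply/msetP=> D; rewrite mset_seqE /m0 !msetE2 !msetnE /=.
by rewrite ![D == _]eq_sym !addnA addn0.
Qed.

(** Evaluate m0 = n + nu n along the chain [-1,0], [0,1], [1,2], where m0 takes
the values 0, 2, 1: hence n takes the values 0, 2 and 1 - 2 there, which is
absurd. *)
Lemma m0_not_speh : ~ speh_type m0.
Proof.
case=> n m0n.
have vals D : count_mem D m0_segments = (n D + n (nu_inv D))%N.
  by rewrite -mset_seqE -m0_seq_mset {1}m0n msetE2 nu_msetE.
have nu12 : nu_inv [sgm 1; 2] = [sgm 0; 1] by apply: val_inj.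
have nu01 : nu_inv [sgm 0; 1] = [sgm -1; 0] by apply: val_inj.
have v0 : 0 = _ := vals [sgm -1; 0].
have v1 : 2 = _ := vals [sgm 0; 1].
have v2 : 1 = _ := vals [sgm 1; 2].
rewrite nu01 in v1; rewrite nu12 in v2; lia.
Qed.

Lemma m0_nonincr_edn_admits_nontrivial o : standard_order m0 o -> nonincr_edn o ->
  admits_nontrivial_relevant o.
Proof.
rewrite m0_seq_mset => /mem_standard_orders o_std o_edn.
have : all (fun o => nonincr_edn o ==>
    has (fun d => ~~ trivial_decomposition d) (relevant_decs o))
  (standard_orders m0_segments) by vm_compute.
by move/allP/(_ o o_std); rewrite o_edn => /hasP[d /mem_relevant_decs]; exists d.
Qed.

Definition m0_failing_orders : seq (seq sgm) :=
  [:: [:: [sgm 1; 1]; [sgm 1; 2]; [sgm 0; 0]; [sgm 0; 1]; [sgm 0; 1]];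
      [:: [sgm 1; 2]; [sgm 1; 1]; [sgm 0; 0]; [sgm 0; 1]; [sgm 0; 1]];
      [:: [sgm 1; 2]; [sgm 0; 1]; [sgm 1; 1]; [sgm 0; 0]; [sgm 0; 1]]].

Lemma mem_m0_failing_orders o :
  o \in m0_failing_orders <-> standard_order m0 o /\ ~ admits_relevant o.
Proof.
have /perm_mem -> : perm_eq m0_failing_orders
    [seq o <- standard_orders m0_segments | relevant_decs o == [::]].
  by vm_compute.
rewrite mem_filter m0_seq_mset; split.
  move=> /andP[none /mem_standard_orders std]; split=> //.
  by move/admits_relevantP; rewrite none.
case=> /mem_standard_orders -> /admits_relevantP; rewrite andbT.
by case: eqVneq.
Qed.

Theorem theorem1p8 :
  [/\ ~ speh_type m0 /\ ~ distinguished m0,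
      forall o : seq sgm, standard_order m0 o -> nonincr_edn o ->
        admits_relevant o,
      forall can : {mset sgm} -> seq sgm, canonical_order_rule can ->
        admits_nontrivial_relevant (can m0)
    & exists s : seq (seq sgm),
        [/\ uniq s,
            size s = 3,
            forall o : seq sgm,
              o \in s <-> standard_order m0 o /\ ~ admits_relevant o
          & count nonincr_bgn s = 2]].
Proof.
split.
- split; first exact: m0_not_speh.
  move=> dist.
  have /mem_m0_failing_orders[o_std] := mem_head _ _ : _ \in m0_failing_orders.
  by apply; apply: dist.
- by move=> o o_std /(m0_nonincr_edn_admits_nontrivial o_std)[d [rel_d _]]; exists d.
- by move=> can /(_ m0)[can_std can_edn]; apply: m0_nonincr_edn_admits_nontrivial.
exists m0_failing_orders.
by split=> //; apply: mem_m0_failing_orders.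
Qed.
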